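(* Let $\lambda\in(0,1)$ be such that $E_\lambda$ is totally self-similar. If $g:\mathbb{R}\to\mathbb{R}$, $g(x)=\mu x+b$ with $\mu,b\in\mathbb{R}$ and $\mu\neq0$, is an affine map with $g(E_\lambda)\subseteq E_\lambda$, then $g=f_{\mathbf{i}}$ for some $\mathbf{i}\in\Omega_\lambda^*$.
   Context: For $\lambda\in(0,1)$ let $\Omega_\lambda=\{0,\lambda,2\}$ and $f_d(x)=\frac{x+d}{3}$ for $d\in\Omega_\lambda$, $x\in\mathbb{R}$. $E_\lambda$ is the unique non-empty compact subset of $\mathbb{R}$ with $E_\lambda=\bigcup_{d\in\Omega_\lambda}f_d(E_\lambda)$. Its convex hull is $I=[0,1]$. $\Omega_\lambda^*=\bigcup_{n\ge 0}\Omega_\lambda^n$ is the set of all finite words over $\Omega_\lambda$, including the empty word $\epsilon$. For $\mathbf{i}=d_1\ldots d_n$ put $f_{\mathbf{i}}=f_{d_1}\circ\cdots\circ f_{d_n}$, and $f_\epsilon$ is the identity map. The set $E_\lambda$ is called totally self-similar if $f_{\mathbf{i}}(E_\lambda)=f_{\mathbf{i}}(I)\cap E_\lambda$ for every $\mathbf{i}\in\Omega_\lambda^*$. *)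

(* Defs.v *)
From HB Require Import structures.
From mathcomp Require Import all_boot all_order all_algebra.
From mathcomp Require Import all_classical all_reals all_analysis.

Set Implicit Arguments.
Unset Strict Implicit.
Unset Printing Implicit Defensive.

Import Order.TTheory GRing.Theory Num.Theory.
Import numFieldNormedType.Exports.

Local Open Scope classical_set_scope.
Local Open Scope ring_scope.

Section SelfSimilar.
Variable R : realType.
Implicit Types (lambda d x : R) (w : seq R) (E : set R).

Definition Omega lambda : set R := [set 0; lambda; 2].

Definition f d x : R := (x + d) / 3.

Definition words lambda : set (seq R) :=
  [set w | forall d, d \in w -> Omega lambda d].

(* [f_word [:: d1; ...; dn]] is f d1 \o ... \o f dn: the first letter is
   applied last. *)
Definition f_word w x : R := foldr f x w.

(* By Hutchinson's theorem exactly one set E satisfies this predicate, so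
   quantifying over such E is the same as speaking of the attractor. *)
Definition is_attractor lambda E : Prop :=
  [/\ E !=set0, compact E & E = \bigcup_(d in Omega lambda) (f d @` E)].

(* `[0, 1] is the convex hull of the attractor when 0 < lambda < 1. *)
Definition totally_self_similar lambda E : Prop :=
  forall w, words lambda w -> f_word w @` E = (f_word w @` `[0, 1]) `&` E.

End SelfSimilar.

(* Main.v *)
Require Import Defs.
From HB Require Import structures.
From mathcomp Require Import all_boot all_order all_algebra.
From mathcomp Require Import all_classical all_reals all_analysis.
From mathcomp Require Import lra.

Set Implicit Arguments.
Unset Strict Implicit.
Unset Printing Implicit Defensive.

Import Order.TTheory GRing.Theory Num.Theory.
Import numFieldNormedType.Exports.

Local Open Scope classical_set_scope.
Local Open Scope ring_scope.

(** Write [G = (gl, gr)] for the central gap of [E], with [gl = (1 + lambda) / 3]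
    and [gr = 2 / 3]; total self-similarity makes every [f_w(G)] disjoint from
    [E], and conversely every open interval in [[0, 1]] disjoint from [E] lies in
    some [f_v(G)]. The interval [g([0, 1])] has end points in [E], so it contains
    some [f_w(G)] with [3^|w| |mu| < 3]. The preimage of [f_w(G)] under [g] misses
    [E], hence lies in some [f_v(G)], and comparing lengths leaves only [v]
    empty. Therefore [h = f_w^-1 o g], of slope [nu] with [1 <= |nu| < 3], satisfies
    [G <= h(G)] and maps [E] into [E] as long as the image stays in [[0, 1]].
    Pulling back [f_2(G)] in the same way shows that, when [nu > 0], the conjugate
    [f_2^-1 o h o f_2] is again such a map; iterating, the translation part of [h]
    increases without bound unless [h] is the identity. When [nu < 0], the same
    argument with the conjugates [f_2^-1 o h o f_d], [d <> 2], makes it increase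
    without bound if [|nu| (2 - lambda) > 2], and otherwise [f_lambda^-1 o h o f_2]
    makes it decrease without bound. *)

(** * Archimedean iteration and powers of 3 *)

Lemma no_escape (R : realType) (P : R -> Prop) (s M : R) :
  0 < s -> (forall x, P x -> x <= M) ->
  (forall x, P x -> exists2 y, P y & x + s <= y) -> forall x, ~ P x.
Proof.
move=> s0 PM Ps x Px.
have [n nP] : exists n : nat, (M - x) / s < n%:R.
  by exists (Num.truncn ((M - x) / s)).+1; exact: truncnS_gt.
have [y Py xy] : exists2 y, P y & x + s * n%:R <= y.
  elim: n {nP} => [|n [y Py xy]]; first by exists x => //; rewrite mulr0 addr0.
  have [z Pz yz] := Ps _ Py; exists z => //.
  by rewrite -natr1; lra.
have := PM _ Py; rewrite ltr_pdivrMr // in nP; lra.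
Qed.

Lemma exp3_gt (R : realType) (x : R) : exists n, x < 3 ^+ n.
Proof.
exists (Num.truncn x).+1; apply: lt_trans (truncnS_gt x) _.
by rewrite -natrX ltr_nat ltn_expl.
Qed.

(** The least exponent that reaches 1 works, since its predecessor stays below 1. *)
Lemma exp3_level (R : realType) (x : R) : 0 < x -> x <= 1 ->
  exists n, 1 <= 3 ^+ n * x /\ 3 ^+ n * x < 3.
Proof.
move=> x0 x1.
have ex : exists n, 1 <= 3 ^+ n * x.
  by have [n /ltW nP] := exp3_gt x^-1; exists n; rewrite -ler_pdivrMr // mul1r.
case: (ex_minnP ex) => -[|n] nP nmin.
  by exists 0; rewrite expr0; split; lra.
exists n.+1; split => //.
rewrite exprS -mulrA; case: (lerP 1 (3 ^+ n * x)) => nx; last by lra.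
by have := nmin _ nx; rewrite ltnn.
Qed.

(** * Words and the slopes of their maps *)

Section Words.
Variables (R : realType) (lambda : R).
Implicit Types (d x y : R) (w : seq R).

Lemma Omega_nonneg d : 0 < lambda -> Omega lambda d -> 0 <= d.
Proof. by move=> l0 [[->|->]|->]; lra. Qed.

Lemma Omega_le2 d : lambda < 1 -> Omega lambda d -> d <= 2.
Proof. by move=> l1 [[->|->]|->]; lra. Qed.

Lemma words_cons d w :
  Omega lambda d -> words lambda w -> words lambda (d :: w).
Proof. by move=> dO wO e; rewrite inE => /predU1P[->//|]; exact: wO. Qed.

Lemma words_head d w : words lambda (d :: w) -> Omega lambda d.
Proof. by apply; rewrite inE eqxx. Qed.

Lemma f_word_nil x : f_word [::] x = x.
Proof. by []. Qed.

Lemma f_word_cons d w x : f_word (d :: w) x = (f_word w x + d) / 3.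
Proof. by []. Qed.

Lemma f_wordB w x y : 3 ^+ size w * (f_word w x - f_word w y) = x - y.
Proof.
elim: w => [|d w IH]; first by rewrite mul1r.
by rewrite -IH !f_word_cons /= exprS; lra.
Qed.

Lemma f_word_affine w x : f_word w x = x / 3 ^+ size w + f_word w 0.
Proof.
have h3 : (3 : R) ^+ size w != 0 by rewrite expf_neq0.
by apply: (mulfI h3); rewrite mulrDr mulrCA divff // mulr1;
  have := f_wordB w x 0; lra.
Qed.

End Words.

(** * Extreme points and the central gap *)

Section Attractor.
Variables (R : realType) (lambda : R) (E : set R).
Hypotheses (lambda_gt0 : 0 < lambda) (lambda_lt1 : lambda < 1).
Hypotheses (attrE : is_attractor lambda E) (tssE : totally_self_similar lambda E).
Implicit Types (a b d p q t x y nu beta : R) (v w : seq R).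

Local Notation gl := ((1 + lambda) / 3 : R).
Local Notation gr := (2 / 3 : R).

(* [lra] does not see section hypotheses. *)
Ltac section_lra := move: lambda_gt0 lambda_lt1 => ? ?; lra.

Lemma Omega0 : Omega lambda 0. Proof. by left; left. Qed.
Lemma Omegal : Omega lambda lambda. Proof. by left; right. Qed.
Lemma Omega2 : Omega lambda 2. Proof. by right. Qed.
Lemma words_nil : words lambda [::]. Proof. by []. Qed.
Hint Resolve Omega0 Omegal Omega2 words_nil : core.

Lemma attractor_letter x : E x <-> exists2 d, Omega lambda d & E (3 * x - d).
Proof.
have [_ _ EE] := attrE; split.
  rewrite {1}EE => -[d dO [y Ey <-]]; exists d => //.
  by rewrite /f (_ : 3 * _ - d = y) //; section_lra.
move=> [d dO Ed]; rewrite EE; exists d => //; exists (3 * x - d) => //.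
by rewrite /f; section_lra.
Qed.

Lemma attractor_f d x : Omega lambda d -> E x -> E ((x + d) / 3).
Proof.
move=> dO Ex; apply/attractor_letter; exists d => //.
by rewrite (_ : 3 * _ - d = x) //; section_lra.
Qed.

(** Compactness gives a maximum [c]: its first digit yields [c <= (c + 2) / 3], and [(c + 2) / 3]
    being in [E] yields the converse. *)
Lemma attractor1_le1 : E 1 /\ forall x, E x -> x <= 1.
Proof.
have [E0 cE _] := attrE.
have [] := @compact_EVT_max R R idfun E E0 cE.
  by apply: continuous_subspaceT => x; exact: cvg_id.
move=> c; rewrite inE => Ec cmax.
have cub x : E x -> x <= c by move=> Ex; apply: cmax; rewrite inE.
have c1 : c <= 1.
  have [d dO Ed] := (attractor_letter c).1 Ec.
  have := Omega_le2 lambda_lt1 dO; have := cub _ Ed; section_lra.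
have c2 := cub _ (attractor_f Omega2 Ec).
have -> : 1 = c by section_lra.
by [].
Qed.

Lemma attractor0_ge0 : E 0 /\ forall x, E x -> 0 <= x.
Proof.
have [E0 cE _] := attrE.
have [] := @compact_EVT_min R R idfun E E0 cE.
  by apply: continuous_subspaceT => x; exact: cvg_id.
move=> c; rewrite inE => Ec cmin.
have clb x : E x -> c <= x by move=> Ex; apply: cmin; rewrite inE.
have c1 : 0 <= c.
  have [d dO Ed] := (attractor_letter c).1 Ec.
  have := Omega_nonneg lambda_gt0 dO; have := clb _ Ed; section_lra.
have c2 := clb _ (attractor_f Omega0 Ec).
have -> : 0 = c by section_lra.
by [].
Qed.

Lemma attractor0 : E 0. Proof. exact: attractor0_ge0.1. Qed.
Lemma attractor1 : E 1. Proof. exact: attractor1_le1.1. Qed.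

Lemma attractor_itv x : E x -> 0 <= x <= 1.
Proof. by move=> Ex; rewrite attractor0_ge0.2 // attractor1_le1.2. Qed.

Lemma attractor_gap x : E x -> x <= gl \/ gr <= x.
Proof.
move=> /attractor_letter[d + /attractor_itv/andP[]].
by move=> [[->|->]|->] x0 x1; [left|left|right]; section_lra.
Qed.

(** Injectivity of [f_word w] turns total self-similarity into a rule for stripping a prefix from a
    point of [E]. *)
Lemma tss_word w x : words lambda w -> 0 <= x <= 1 -> E (f_word w x) -> E x.
Proof.
move=> wO x01 Ew.
have : (f_word w @` E) (f_word w x) by rewrite tssE //; split => //; exists x.
move=> [y Ey yx].
have -> : x = y by apply/esym/eqP; rewrite -subr_eq0 -(f_wordB w) yx subrr mulr0.
by [].
Qed.

Lemma tss_letter d x :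
  Omega lambda d -> 0 <= x <= 1 -> E ((x + d) / 3) -> E x.
Proof. by move=> dO; apply: (@tss_word [:: d]); exact: words_cons. Qed.

Lemma tss_scale d x : Omega lambda d -> E x -> 0 <= 3 * x - d <= 1 ->
  E (3 * x - d).
Proof.
move=> dO Ex x01; apply: (tss_letter dO x01).
by rewrite (_ : _ / 3 = x) //; section_lra.
Qed.

(** * Holes of [E] and the lower bound on [lambda] *)

(** Induction on the scale: a hole inside one piece is stretched threefold. The points 2/3, [gl] and
    1/3 lie in [E], so the hole falls into the piece of 2, the central gap, the piece of [lambda] or
    the piece of 0. *)
Lemma hole_in_gap n a b : 1 < 3 ^+ n * (b - a) -> 0 <= a -> b <= 1 ->
  (forall x, E x -> a < x -> x < b -> False) ->
  exists v, [/\ words lambda v, f_word v gl <= a & b <= f_word v gr].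
Proof.
elim: n a b => [|n IH] a b ab a0 b1 hole; first by rewrite expr0 in ab; section_lra.
have scale d : Omega lambda d -> d / 3 <= a -> b <= (1 + d) / 3 ->
    exists v, [/\ words lambda v, f_word v gl <= a & b <= f_word v gr].
  move=> dO da bd.
  have [||||v [vO va bv]] := IH (3 * a - d) (3 * b - d).
  - by move: ab; rewrite exprS; section_lra.
  - section_lra.
  - section_lra.
  - move=> x Ex ax xb.
    by apply: hole (attractor_f dO Ex) _ _; section_lra.
  by exists (d :: v); split; [exact: words_cons| |]; rewrite f_word_cons; section_lra.
have out x : E x -> x <= a \/ b <= x.
  move=> Ex; case: (lerP x a) => xa; first by left.
  by case: (lerP b x) => bx; [right|have := hole _ Ex xa bx].
have ab0 : a < b.
  have h3 : (0 : R) < 3 ^+ n.+1 by rewrite exprn_gt0.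
  by rewrite -subr_gt0 -(pmulr_rgt0 _ h3); section_lra.
have [a1|b2] := out _ (attractor_f Omega2 attractor0); first by apply: (scale 2) => //; section_lra.
have [a1|b3] := out _ (attractor_f Omegal attractor1).
  by exists [::]; split => //; rewrite f_word_nil; section_lra.
have [a1|b4] := out _ (attractor_f Omega0 attractor1).
  by apply: (scale lambda) => //; section_lra.
by apply: (scale 0) => //; section_lra.
Qed.

Lemma word_gapB v : 3 ^+ size v * (f_word v gr - f_word v gl) = (1 - lambda) / 3.
Proof. by rewrite f_wordB; section_lra. Qed.

Lemma f_word_01 w x : words lambda w -> 0 <= x <= 1 -> 0 <= f_word w x <= 1.
Proof.
elim: w => // d w IH /[dup] /words_head dO wO x01.
have := IH _ x01; rewrite f_word_cons.
have wO' : words lambda w by move=> e ew; apply: wO; rewrite inE ew orbT.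
move=> /(_ wO'); have := Omega_le2 lambda_lt1 dO.
by have := Omega_nonneg lambda_gt0 dO; section_lra.
Qed.

Lemma word_gap_hole w x : words lambda w -> E x ->
  f_word w gl < x -> x < f_word w gr -> False.
Proof.
move=> wO Ex lx xr.
have h3 : (0 : R) < 3 ^+ size w by rewrite exprn_gt0.
pose y := 3 ^+ size w * (x - f_word w 0).
have xE : x = f_word w y.
  by rewrite f_word_affine /y mulrAC divff ?gt_eqF // mul1r; section_lra.
have lt z z' : (f_word w z < f_word w z') = (z < z').
  by rewrite -subr_gt0 -(pmulr_rgt0 _ h3) f_wordB subr_gt0.
rewrite xE !lt in lx xr.
have Ey : E y by apply: (tss_word wO); [section_lra|rewrite -xE].
by case: (attractor_gap Ey); section_lra.
Qed.

Lemma hole_sub_gap a b : a < b -> 0 <= a -> b <= 1 ->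
  (forall x, E x -> a < x -> x < b -> False) ->
  exists v, [/\ words lambda v, f_word v gl <= a & b <= f_word v gr].
Proof.
move=> ab; have [n nP] := exp3_gt (b - a)^-1.
apply: (@hole_in_gap n).
by rewrite -ltr_pdivrMr ?subr_gt0 // mul1r.
Qed.

(** The gap of a word [v] has length [(1 - lambda) / 3] divided by [3 ^+ size v], so comparing gaps
    compares word lengths. *)
Lemma size_word_le v w nu :
  f_word w gr - f_word w gl <= nu * (f_word v gr - f_word v gl) ->
  3 ^+ size v <= 3 ^+ size w * nu.
Proof.
have D0 : 0 < (1 - lambda) / 3 by section_lra.
have := word_gapB w; have := word_gapB v.
have : (0 : R) < 3 ^+ size v by rewrite exprn_gt0.
have : (0 : R) < 3 ^+ size w by rewrite exprn_gt0.
move: (3 ^+ size v) (3 ^+ size w) => a c c0 a0 av cw.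
move=> wv; rewrite -(ler_pM2l (mulr_gt0 a0 c0)) in wv.
by rewrite -(ler_pM2r D0) -{1}cw -av; lra.
Qed.

(** The point [f_0(lambda) = f_lambda(0)] puts [lambda] in [E]. If [lambda] lay below the central
    gap, that gap shifted left by [lambda] would be a hole, because [f_0(x + lambda) = f_lambda(x)];
    its length would force it into the central gap itself. *)
Lemma lambda_ge : 2 / 3 <= lambda.
Proof.
rewrite leNgt; apply/negP => lambda_small.
have El : E lambda.
  apply: (tss_letter Omega0); first by section_lra.
  by rewrite addr0 -[lambda]add0r; exact: (attractor_f Omegal attractor0).
have lgl : lambda <= gl by case: (attractor_gap El) => //; section_lra.
have [|||x Ex xl xr|v [vO vl vr]] := @hole_sub_gap (gl - lambda) (gr - lambda).
- by section_lra.
- by section_lra.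
- by section_lra.
- have : E (x + lambda).
    apply: (tss_letter Omega0); first by section_lra.
    by rewrite addr0; exact: attractor_f.
  by case/attractor_gap; section_lra.
have : 3 ^+ size v <= 3 ^+ size ([::] : seq R) * 1 :> R.
  by apply: size_word_le; rewrite !f_word_nil; section_lra.
case: v vO vl vr => [|d v] vO vl vr; first by move: vl; rewrite f_word_nil; section_lra.
have : (1 : R) <= 3 ^+ size v by rewrite exprn_ege1 //; section_lra.
by rewrite expr0 /= exprS; section_lra.
Qed.

(** Images outside [[0, 1]] are ignored because total self-similarity transfers membership only for
    points of [[0, 1]]. *)
Definition partial_embedding nu beta :=
  forall x, E x -> 0 <= nu * x + beta <= 1 -> E (nu * x + beta).

(* The map [x |-> nu * x + (3 * beta + nu * e - d)] is
   [f_d^-1 o (x |-> nu * x + beta) o f_e]. *)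
Lemma partial_embedding_conj nu beta d e :
  Omega lambda d -> Omega lambda e -> partial_embedding nu beta ->
  partial_embedding nu (3 * beta + nu * e - d).
Proof.
move=> dO eO pe x Ex y01.
have := Omega_nonneg lambda_gt0 dO; have := Omega_le2 lambda_lt1 dO => d2 d0.
apply: (tss_letter dO y01).
have -> : (nu * x + (3 * beta + nu * e - d) + d) / 3 = nu * ((x + e) / 3) + beta by lra.
by apply: pe; [exact: attractor_f|lra].
Qed.

Lemma pullback_pos nu beta w : 0 < nu -> words lambda w ->
  partial_embedding nu beta ->
  beta <= f_word w gl -> f_word w gr <= nu + beta ->
  exists v, [/\ words lambda v, 3 ^+ size v <= 3 ^+ size w * nu,
    nu * f_word v gl + beta <= f_word w gl &
    f_word w gr <= nu * f_word v gr + beta].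
Proof.
move=> nu0 wO pe wl wr.
have nuK y : nu * ((y - beta) / nu) = y - beta by rewrite mulrC divfK ?gt_eqF.
have lt x y : (x < y) = (nu * x < nu * y) by rewrite ltr_pM2l.
have le x y : (x <= y) = (nu * x <= nu * y) by rewrite ler_pM2l.
have w3 : (0 : R) < 3 ^+ size w by rewrite exprn_gt0.
have lr : f_word w gl < f_word w gr.
  by rewrite -subr_gt0 -(pmulr_rgt0 _ w3) word_gapB; section_lra.
have [wl01 wr01] : 0 <= f_word w gl <= 1 /\ 0 <= f_word w gr <= 1.
  by split; apply: f_word_01 => //; section_lra.
have [|||x Ex|v [vO]] := @hole_sub_gap ((f_word w gl - beta) / nu) ((f_word w gr - beta) / nu).
- by rewrite lt !nuK; lra.
- by rewrite le nuK; lra.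
- by rewrite le nuK; lra.
- rewrite (lt _ x) (lt x) !nuK => lx xr; apply: (word_gap_hole wO (pe x Ex _)); lra.
rewrite (le (f_word v gl)) (le _ (f_word v gr)) !nuK => vl vr.
by exists v; split => //; [apply: size_word_le| |]; lra.
Qed.

Lemma pullback_neg nu beta w : 0 < nu -> words lambda w ->
  partial_embedding (- nu) beta ->
  beta - nu <= f_word w gl -> f_word w gr <= beta ->
  exists v, [/\ words lambda v, 3 ^+ size v <= 3 ^+ size w * nu,
    f_word w gr <= beta - nu * f_word v gl &
    beta - nu * f_word v gr <= f_word w gl].
Proof.
move=> nu0 wO pe wl wr.
have nuK y : nu * ((beta - y) / nu) = beta - y by rewrite mulrC divfK ?gt_eqF.
have lt x y : (x < y) = (nu * x < nu * y) by rewrite ltr_pM2l.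
have le x y : (x <= y) = (nu * x <= nu * y) by rewrite ler_pM2l.
have w3 : (0 : R) < 3 ^+ size w by rewrite exprn_gt0.
have lr : f_word w gl < f_word w gr.
  by rewrite -subr_gt0 -(pmulr_rgt0 _ w3) word_gapB; section_lra.
have [wl01 wr01] : 0 <= f_word w gl <= 1 /\ 0 <= f_word w gr <= 1.
  by split; apply: f_word_01 => //; section_lra.
have [|||x Ex|v [vO]] := @hole_sub_gap ((beta - f_word w gr) / nu) ((beta - f_word w gl) / nu).
- by rewrite lt !nuK; lra.
- by rewrite le nuK; lra.
- by rewrite le nuK; lra.
- rewrite (lt _ x) (lt x) !nuK => lx xr; apply: (word_gap_hole wO (pe x Ex _)); lra.
rewrite (le (f_word v gl)) (le _ (f_word v gr)) !nuK => vl vr.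
by exists v; split => //; [apply: size_word_le| |]; lra.
Qed.

Lemma short_word v : words lambda v -> 3 ^+ size v < (9 : R) ->
  v = [::] \/ exists2 d, Omega lambda d & v = [:: d].
Proof.
case: v => [|d [|e v]] vO; [by left| |].
  by right; exists d => //; exact: words_head vO.
have : (1 : R) <= 3 ^+ size v by rewrite exprn_ege1 //; lra.
by rewrite /= !exprS => v1 v9; exfalso; lra.
Qed.

Lemma pos_id nu beta : 1 <= nu -> nu < 3 -> partial_embedding nu beta ->
  nu * gl + beta <= gl -> gr <= nu * gr + beta -> nu = 1 /\ beta = 0.
Proof.
move=> nu1 nu3 pe hl hr.
case: (lerP nu 1) => nu1'.
  have nuE : nu = 1 by lra.
  by subst nu; split => //; lra.
pose P z := [/\ partial_embedding nu z, nu * gl + z <= gl & gr <= nu * gr + z].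
(* The increment is [2 * z + 2 * (nu - 1)], estimated with [z >= gr - nu * gr]; the bound 0 comes
   from [nu * gl + z <= gl]. *)
exfalso; apply: (@no_escape _ P (2 * (nu - 1) / 3) 0 _ _ _ beta) => //.
- by lra.
- move=> z [_ zl _].
  have : 0 <= (nu - 1) * gl by apply: mulr_ge0; section_lra.
  lra.
move=> z [pez zl zr].
have l23 := lambda_ge.
have [||||v [vO vs vl vr]] := @pullback_pos nu z [:: 2] _ _ pez.
- by lra.
- exact: words_cons.
- rewrite f_word_cons f_word_nil.
  have : 0 <= (nu - 1) * gl by apply: mulr_ge0; section_lra.
  by section_lra.
- by rewrite f_word_cons f_word_nil; section_lra.
have {vs} : 3 ^+ size v < (9 : R) by move: vs; rewrite expr1; lra.
case/(short_word vO) => [vE|[d dO vE]]; move: vl vr; rewrite vE ?f_word_cons !f_word_nil.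
  (* Here [nu * gr + z < gl + 3 * (gr - gl) <= 8 / 9], the last by [lambda_ge], and 8/9 is
     [f_2(gr)]. *)
  move=> _ vr; exfalso.
  have : 0 < (3 - nu) * (gr - gl) by apply: mulr_gt0; section_lra.
  by section_lra.
have dl : Omega lambda d -> d = 2 \/ d <= lambda by move=> [[->|->]|->]; [right|right|left]; section_lra.
have [->|{}dl] := dl dO.
  move=> vl vr; exists (3 * z + nu * 2 - 2); last by lra.
  by split; [exact: partial_embedding_conj|lra|lra].
(* For [d <= lambda], [f_d(gr) <= gl], so the image of [f_d(G)] ends too far left to cover
   [f_2(G)]. *)
move=> _ vr; exfalso.
have : 0 <= nu * (gl - (gr + d) / 3) by apply: mulr_ge0; section_lra.
by section_lra.
Qed.

Lemma neg_impossible nu beta : 1 <= nu -> nu < 3 ->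
  partial_embedding (- nu) beta ->
  gr <= beta - nu * gl -> beta - nu * gr <= gl -> False.
Proof.
move=> nu1 nu3 pe hl hr.
have l23 := lambda_ge.
pose P z := [/\ partial_embedding (- nu) z, gr <= z - nu * gl & z - nu * gr <= gl].
have Plarge z : P z -> 1 <= z.
  move=> [_ zl _].
  have : 0 <= (nu - 1) * gl by apply: mulr_ge0; section_lra.
  by section_lra.
have Psmall z : P z -> z <= 3 by move=> [_ _ zr]; section_lra.
have nul : 0 <= (nu - 1) * lambda by apply: mulr_ge0; section_lra.
have gap2 : 0 < (3 - nu) * (gr - gl) by apply: mulr_gt0; section_lra.
have Omega_le d : Omega lambda d -> d = 2 \/ d <= lambda.
  by move=> [[->|->]|->]; [right|right|left]; section_lra.
have nu2 : nu * (2 - lambda) <= 2.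
  rewrite leNgt; apply/negP => nu2.
  (* The increment [2 * z - nu * d - 2] is estimated with [z >= gr + nu * gl] and [d <= lambda]. *)
  apply: (@no_escape _ P ((nu * (2 - lambda) - 2) / 3) 3 _ Psmall _ beta) => //.
    by lra.
  move=> z Pz; have [pez zl zr] := Pz; have z1 := Plarge _ Pz.
  have [||||v [vO vs vl vr]] := @pullback_neg nu z [:: 2] _ _ pez.
  - by lra.
  - exact: words_cons.
  - by rewrite f_word_cons f_word_nil; section_lra.
  - by rewrite f_word_cons f_word_nil; section_lra.
  have {vs} : 3 ^+ size v < (9 : R) by move: vs; rewrite expr1; lra.
  case/(short_word vO) => [vE|[d dO vE]]; move: vl vr; rewrite vE ?f_word_cons !f_word_nil.
    by move=> vl _; exfalso; section_lra.
  have [->|dl] := Omega_le _ dO.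
    move=> vl _; exfalso.
    have : 0 <= nu * ((gl + 2) / 3 - gr) by apply: mulr_ge0; section_lra.
    by section_lra.
  move=> vl vr; exists (3 * z + - nu * d - 2).
    by split; [exact: partial_embedding_conj|lra|lra].
  have : 0 <= nu * (lambda - d) by apply: mulr_ge0; section_lra.
  by section_lra.
have {}nu2 : nu < 2.
  have : 0 < nu * (1 - lambda) by apply: mulr_gt0; section_lra.
  by section_lra.
have gap1 : 0 < (2 - nu) * (gr - gl) by apply: mulr_gt0; section_lra.
(* Negation turns the decrease into an increase. The translation part [c] drops by
   [2 * nu + lambda - 2 * c], at least [lambda / 3] since [c <= gl + nu * gr] and [nu >= 1]. *)
apply: (@no_escape _ (fun z => P (- z)) (lambda / 3) 0 _ _ _ (- beta)).
- by section_lra.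
- by move=> z /Plarge; lra.
- move=> z Pz; have [pez zl zr] := Pz; have z1 := Plarge _ Pz.
  have [||||v [vO vs vl vr]] := @pullback_neg nu (- z) [:: lambda] _ _ pez.
  - by lra.
  - exact: words_cons.
  - by rewrite f_word_cons f_word_nil; section_lra.
  - by rewrite f_word_cons f_word_nil; section_lra.
  have {vs} : 3 ^+ size v < (9 : R) by move: vs; rewrite expr1; lra.
  case/(short_word vO) => [vE|[d dO vE]]; move: vl vr; rewrite vE ?f_word_cons !f_word_nil.
    (* With [nu < 2] the image of the central gap starts above [2 * gl - gr], which is at least
       [f_lambda(gl)]. *)
    by move=> _ vr; exfalso; section_lra.
  have [->|dl] := Omega_le _ dO.
    move=> vl vr; exists (- (3 * (- z) + - nu * 2 - lambda)); last by section_lra.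
    by rewrite opprK; split; [exact: partial_embedding_conj|lra|lra].
  move=> _ vr; exfalso.
  have : 0 <= nu * (gl - (gr + d) / 3) by apply: mulr_ge0; section_lra.
  by section_lra.
- by rewrite opprK.
Qed.

(** * Gaps between two points of [E] *)

(* The union of [[p, 1]] and [t + [0, r]] is a rescaled [[p, q]] straddling the
   overlap of the pieces [f_0([0, 1])] and [f_lambda([0, 1])]. *)
Lemma gap_in_two_pieces n t p r : E p -> E r -> t < 1 -> p < t -> 1 < r + t ->
  1 <= 3 ^+ n * (r + t - p) ->
  exists v, [/\ words lambda v, (size v <= n)%N &
    (p <= f_word v gl /\ f_word v gr <= r + t) \/
    (p <= f_word v gl + t /\ f_word v gr <= r)].
Proof.
have l23 := lambda_ge.
elim: n t p r => [|n IH] t p r Ep Er t1 pt rt len.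
all: have [p0 r1] := (attractor_itv Ep, attractor_itv Er).
all: case: (attractor_gap Ep) => pg;
  first by exists [::]; split => //; left; rewrite !f_word_nil; section_lra.
all: case: (attractor_gap Er) => rg;
  last by exists [::]; split => //; right; rewrite !f_word_nil; section_lra.
  by exfalso; move: len; rewrite expr0; section_lra.
case: (lerP r (1 / 3)) => r3; last first.
  exists [:: 0]; split => //; first exact: words_cons.
  by right; rewrite !f_word_cons !f_word_nil; section_lra.
(* Since [f_0(y) + t = f_2(y + 3 * t - 2)], zooming in on both pieces changes the offset [t] into
   [3 * t - 2]. *)
have [|||||| v [vO vn vE]] := IH (3 * t - 2) (3 * p - 2) (3 * r - 0).
- by apply: tss_scale => //; section_lra.
- by apply: tss_scale => //; section_lra.
- by section_lra.
- by section_lra.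
- by section_lra.
- by move: len; rewrite exprS; section_lra.
case: vE => vE; [exists (2 :: v)|exists (0 :: v)]; split => //.
- exact: words_cons.
- by left; rewrite !f_word_cons; section_lra.
- exact: words_cons.
- by right; rewrite !f_word_cons; section_lra.
Qed.

(** Either the central gap separates [p] from [q], or one piece contains both and is rescaled, or
    they straddle the overlap of the pieces of 0 and [lambda], which is [gap_in_two_pieces]. *)
Lemma gap_in_itv n p q : E p -> E q -> 1 <= 3 ^+ n * (q - p) ->
  exists v, [/\ words lambda v, (size v <= n)%N, p <= f_word v gl & f_word v gr <= q].
Proof.
have l23 := lambda_ge.
elim: n p q => [|n IH] p q Ep Eq len.
all: have [p01 q01] := (attractor_itv Ep, attractor_itv Eq).
  exists [::]; split => //; rewrite f_word_nil; move: len; rewrite expr0; section_lra.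
have scale d : Omega lambda d -> d / 3 <= p -> q <= (1 + d) / 3 -> p <= q ->
    exists v, [/\ words lambda v, (size v <= n.+1)%N, p <= f_word v gl & f_word v gr <= q].
  move=> dO dp qd pq.
  have [|||v [vO vn pv vq]] := IH (3 * p - d) (3 * q - d).
  - by apply: tss_scale => //; section_lra.
  - by apply: tss_scale => //; section_lra.
  - by move: len; rewrite exprS; section_lra.
  by exists (d :: v); split => //; [exact: words_cons| |]; rewrite f_word_cons; section_lra.
have pq : p <= q.
  have h3 : (0 : R) < 3 ^+ n.+1 by rewrite exprn_gt0.
  by rewrite -subr_ge0 -(pmulr_rge0 _ h3); section_lra.
case: (attractor_gap Ep) => pg; last by apply: (scale 2) => //; section_lra.
case: (attractor_gap Eq) => qg; last first.
  by exists [::]; split => //; rewrite f_word_nil; section_lra.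
case: (lerP q (1 / 3)) => q3; first by apply: (scale 0) => //; section_lra.
case: (lerP (lambda / 3) p) => p3; first by apply: (scale lambda) => //; section_lra.
have [||||||v [vO vn vE]] := @gap_in_two_pieces n lambda (3 * p - 0) (3 * q - lambda).
- by apply: tss_scale => //; section_lra.
- by apply: tss_scale => //; section_lra.
- by section_lra.
- by section_lra.
- by section_lra.
- by move: len; rewrite exprS; section_lra.
case: vE => vE; [exists (0 :: v)|exists (lambda :: v)]; split => //; try exact: words_cons.
all: by rewrite f_word_cons; section_lra.
Qed.

(** * Affine maps of [E] into itself *)

(** The map in the conclusion is [f_w^-1 o g], where [g x = mu * x + b]. *)
Lemma partial_embedding_word mu b w : words lambda w ->
  (forall x, E x -> E (mu * x + b)) ->
  partial_embedding (3 ^+ size w * mu) (3 ^+ size w * (b - f_word w 0)).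
Proof.
move=> wO gE x Ex y01; apply: (tss_word wO y01).
have h3 : (3 : R) ^+ size w != 0 by rewrite expf_neq0.
rewrite f_word_affine -mulrA -mulrDr mulrAC divff // mul1r.
by rewrite addrA subrK; exact: gE.
Qed.

Lemma affine_gap_word mu b : mu != 0 -> (forall x, E x -> E (mu * x + b)) ->
  exists w, [/\ words lambda w, 1 <= 3 ^+ size w * `|mu|, 3 ^+ size w * `|mu| < 3 &
    (0 < mu /\ mu * gl + b <= f_word w gl /\ f_word w gr <= mu * gr + b) \/
    (mu < 0 /\ f_word w gr <= mu * gl + b /\ mu * gr + b <= f_word w gl)].
Proof.
move=> mu0 gE.
have := gE _ attractor0; have := gE _ attractor1; rewrite mulr0 mulr1 add0r => Eb1 Eb0.
have [b1 b0] := (attractor_itv Eb1, attractor_itv Eb0).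
have short v : words lambda v -> 3 ^+ size v < (3 : R) -> v = [::].
  case: v => // d v _.
  have : (1 : R) <= 3 ^+ size v by rewrite exprn_ege1 //; lra.
  by rewrite /= exprS => v1 v9; exfalso; lra.
have mu1 : `|mu| <= 1 by rewrite ler_norml; lra.
have [n [n1 n3]] : exists n, 1 <= 3 ^+ n * `|mu| /\ 3 ^+ n * `|mu| < 3.
  by apply: exp3_level; rewrite ?normr_gt0.
have level w : (size w <= n)%N -> 3 ^+ size w * `|mu| < 3.
  move=> wn; apply: le_lt_trans n3; rewrite ler_pM2r ?normr_gt0 //.
  by rewrite ler_weXn2l //; lra.
have pe : partial_embedding mu b by move=> x Ex _; exact: gE.
case: (ltrP 0 mu) => mu_sign.
  rewrite gtr0_norm // in n1 level *.
  have [//|//||w [wO wn pw wq]] := @gap_in_itv n b (mu + b).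
    by rewrite addrK.
  have [v [vO vs vl vr]] := pullback_pos mu_sign wO pe pw wq.
  (* The bound [vs] is below 3, which leaves only the empty word; [vs] then becomes the lower bound
     on [3 ^+ size w * mu]. *)
  have vE : v = [::] by apply: short => //; apply: le_lt_trans vs _; exact: level.
  subst v; move: vs vl vr; rewrite !f_word_nil /= expr0 => vs vl vr.
  by exists w; split => //; [exact: level|left].
have {mu0}mu_neg : mu < 0 by rewrite lt_neqAle mu0.
rewrite ltr0_norm // in n1 level *.
have [//|//||w [wO wn pw wq]] := @gap_in_itv n (mu + b) b.
  by rewrite opprD addrCA subrr addr0.
have nu0 : 0 < - mu by rewrite oppr_gt0.
have pe' : partial_embedding (- - mu) b by rewrite opprK.
have [||v [vO vs vl vr]] := pullback_neg nu0 wO pe'; [by lra|by lra|].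
have vE : v = [::] by apply: short => //; apply: le_lt_trans vs _; exact: level.
subst v; move: vs vl vr; rewrite !f_word_nil /= expr0 => vs vl vr.
by exists w; split => //; [exact: level|right; split => //; lra].
Qed.

Lemma affine_embedding_word mu b : mu != 0 -> (forall x, E x -> E (mu * x + b)) ->
  exists w, words lambda w /\ forall x, mu * x + b = f_word w x.
Proof.
move=> mu0 gE; have [w [wO nu1 nu3 gap]] := affine_gap_word mu0 gE.
have pe := partial_embedding_word wO gE.
have w3 : (0 : R) < 3 ^+ size w by rewrite exprn_gt0.
have conj x : 3 ^+ size w * mu * x + 3 ^+ size w * (b - f_word w 0) =
    3 ^+ size w * (mu * x + b - f_word w 0).
  by rewrite -mulrA -mulrDr addrA.
have wordK x : 3 ^+ size w * (f_word w x - f_word w 0) = x.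
  by rewrite f_wordB subr0.
case: gap => -[mu_sign [hl hr]].
  rewrite gtr0_norm // in nu1 nu3.
  have [||nuE betaE] := pos_id nu1 nu3 pe.
  - by rewrite conj -[leRHS]wordK ler_pM2l // lerD2r.
  - by rewrite conj -[leLHS]wordK ler_pM2l // lerD2r.
  exists w; split => // x.
  apply: (addIr (- f_word w 0)); apply: (mulfI (lt0r_neq0 w3)).
  by rewrite wordK -conj nuE betaE mul1r addr0.
exfalso; rewrite ltr0_norm // in nu1 nu3.
apply: (neg_impossible nu1 nu3 (beta := 3 ^+ size w * (b - f_word w 0))).
- by rewrite mulrN opprK.
- by rewrite mulrN mulNr opprK addrC conj -[leLHS]wordK ler_pM2l // lerD2r.
- by rewrite mulrN mulNr opprK addrC conj -[leRHS]wordK ler_pM2l // lerD2r.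
Qed.

End Attractor.

Theorem theorem3 (R : realType) (lambda : R) (E : set R)
    (hlambda0 : 0 < lambda) (hlambda1 : lambda < 1)
    (hE : is_attractor lambda E) (htss : totally_self_similar lambda E)
    (g : R -> R) (mu b : R) (hmu : mu != 0)
    (hg : forall x : R, g x = mu * x + b) (hgE : g @` E `<=` E) :
  exists w : seq R, words lambda w /\ g = f_word w.
Proof.
have gE x : E x -> E (mu * x + b) by move=> Ex; rewrite -hg; apply: hgE; exists x.
have [w [wO gw]] := affine_embedding_word hlambda0 hlambda1 hE htss hmu gE.
by exists w; split => //; apply/funext => x; rewrite hg.
Qed.
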